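(* Let $k,\ell\ge 0$ be integers. Then there exist real numbers $a=a(k,\ell)$ and $b=b(k,\ell)$, depending only on $k$ and $\ell$, such that for every positive integer $n$, all partitions $\lambda,\mu\in H(k,\ell;n)$ and every partition $\rho\vdash n$, the Kronecker multiplicity satisfies $\kappa(\lambda,\mu,\rho)\le a\cdot n^b$.
   Context: The base field has characteristic zero. For a partition $\lambda\vdash n$, $\chi^\lambda$ denotes the corresponding irreducible character of the symmetric group $S_n$. For two characters $\varphi,\psi$ of $S_n$ (same $n$), the Kronecker (inner tensor) product is the character $(\varphi\otimes\psi)(\sigma)=\varphi(\sigma)\psi(\sigma)$, $\sigma\in S_n$. For $\lambda,\mu\vdash n$, the Kronecker multiplicities $\kappa(\lambda,\mu,\rho)$ are the non-negative integers defined by $\chi^\lambda\otimes\chi^\mu=\sum_{\rho\vdash n}\kappa(\lambda,\mu,\rho)\chi^\rho$. The $(k,\ell)$-hook is $H(k,\ell;n)=\{\lambda=(\lambda_1,\lambda_2,\ldots)\vdash n\mid \lambda_{k+1}\le\ell\}$. *)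

(* Defs.v *)
From HB Require Import structures.
From mathcomp Require Import all_boot all_order all_algebra all_fingroup.
From mathcomp Require Import all_solvable all_field all_character.
From mathcomp Require Import reals exp.

Set Implicit Arguments.
Unset Strict Implicit.
Unset Printing Implicit Defensive.

Import Order.TTheory GRing.Theory Num.Theory.

Local Open Scope ring_scope.

(* A partition of n, padded with zeros to length n; every part is at most n,
   so this representation is exact and unique. *)
Record intpart (n : nat) := IntPart {
  intpart_tuple : n.-tuple 'I_n.+1;
  _ : let s := map val intpart_tuple in sorted geq s && (sumn s == n)
}.

HB.instance Definition _ (n : nat) := [isSub for @intpart_tuple n].
HB.instance Definition _ (n : nat) := [Finite of intpart n by <:].

Definition parts (n : nat) (lam : intpart n) : seq nat :=
  map val (intpart_tuple lam).

(* Indices start at 0: [part lam i] is the part usually written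
   lambda_(i+1), and it is 0 for every i >= n. *)
Definition part (n : nat) (lam : intpart n) (i : nat) : nat :=
  nth 0%N (parts lam) i.

(* lambda_(k+1) <= l, with indices from 0. *)
Definition hook (k l n : nat) : {set intpart n} :=
  [set lam : intpart n | (part lam k <= l)%N].

(* Row and column of the box containing i in the standard tableau of shape lam
   filled with 0, ..., n-1 row after row, from left to right. *)
Definition tableau_row (n : nat) (lam : intpart n) (i : 'I_n) : nat :=
  reshape_index (parts lam) i.
Definition tableau_col (n : nat) (lam : intpart n) (i : 'I_n) : nat :=
  reshape_offset (parts lam) i.

Definition row_stab (n : nat) (lam : intpart n) : {set 'S_n} :=
  [set s : 'S_n | [forall i, tableau_row lam (s i) == tableau_row lam i]].
Definition col_stab (n : nat) (lam : intpart n) : {set 'S_n} :=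
  [set s : 'S_n | [forall i, tableau_col lam (s i) == tableau_col lam i]].

Section YoungCharacter.

Variables (n : nat) (lam : intpart n).

Local Notation reg := (regular_repr algC [set: 'S_n]%G).

(* The Young symmetrizer, an element of the group algebra of 'S_n, which is
   identified with its image in the regular representation. *)
Definition young_symmetrizer : 'M[algC]_#|[set: 'S_n]%G| :=
  (\sum_(p in row_stab lam) reg p)
    *m (\sum_(q in col_stab lam) (-1) ^+ odd_perm q *: reg q).

(* MathComp representations act on row vectors from the right, and s * t is
   "s, then t" in 'S_n: the right ideal generated by the symmetrizer is the
   left ideal for the usual composition of permutations. *)
Definition young_ideal : 'M[algC]_#|[set: 'S_n]%G| :=
  cyclic_mx reg (gring_row young_symmetrizer).

Definition young_repr :
    mx_representation algC [set: 'S_n]%G (\rank young_ideal) :=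
  submod_repr (cyclic_mx_module reg (gring_row young_symmetrizer)).

Definition chi : 'CF([set: 'S_n]%G) := cfRepr young_repr.

End YoungCharacter.

(* The product of 'CF(G) is pointwise, so that chi lam * chi mu is the
   Kronecker product of the two characters. *)
Definition kronecker_multiplicities (n : nat) (lam mu : intpart n)
    (kappa : intpart n -> nat) : Prop :=
  chi lam * chi mu = \sum_(rho : intpart n) (kappa rho)%:R *: chi rho.

(* Main.v *)
(* For [lam] in the hook, colour each of the first [k] rows of the standard
   tableau, and each of the first [l] columns of the remaining boxes, with its
   own colour, and let [H] be the group of permutations preserving colours.
   The Young symmetrizer factors through the idempotent that averages over [H]
   (with signs on the column colours), so [chi lam] is contained in a character
   [F], induced from a linear character of [H], and [`|F g|] is at most the
   number of colourings of [0, ..., n-1] fixed by [g].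
   If [F1] and [F2] arise in this way from [lam] and [mu], each multiplicity in
   [chi lam * chi mu] is at most the squared norm of [F1 * F2], hence at most
   the average over 'S_n of the number of fixed colourings with [d ^ 4] colours,
   [d] being the number of colours above.  By Burnside this average is the
   number of orbits of such colourings; an orbit is determined by how often
   each colour occurs, so there are at most [n.+1 ^ (d ^ 4)] orbits. *)
Require Import Defs.
From mathcomp Require Import all_boot all_order all_algebra all_fingroup.
From mathcomp Require Import all_solvable all_field all_character.
From mathcomp Require Import reals exp.

Set Implicit Arguments.
Unset Strict Implicit.
Unset Printing Implicit Defensive.

Import Order.TTheory GRing.Theory Num.Theory.

Local Open Scope ring_scope.

(** * Characters of submodules as traces of projections *)

Section Projections.

Variables (gT : finGroupType) (G : {group gT}) (n : nat).
Variable rG : mx_representation algC G n.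

Definition intertwines (Q : 'M[algC]_n) : Prop :=
  forall g, g \in G -> rG g *m Q = Q *m rG g.

Lemma intertwines_mul Q1 Q2 :
  intertwines Q1 -> intertwines Q2 -> intertwines (Q1 *m Q2).
Proof. by move=> c1 c2 g Gg; rewrite mulmxA c1 // -!mulmxA c2. Qed.

Lemma intertwines_sub Q1 Q2 :
  intertwines Q1 -> intertwines Q2 -> intertwines (Q1 - Q2).
Proof. by move=> c1 c2 g Gg; rewrite mulmxBr mulmxBl c1 ?c2. Qed.

Lemma intertwines_mxmodule Q : intertwines Q -> mxmodule rG Q.
Proof. by move=> cQ; apply/mxmoduleP=> g Gg; rewrite -cQ ?submxMl. Qed.

(** [Q] projects onto [U], so it factors as [X *m row_base U] with [row_base U *m X = 1]; cyclicity
    of the trace leaves the matrix of [g] in that basis. *)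
Lemma cfRepr_submod_trace (U Q : 'M[algC]_n) (Umod : mxmodule rG U) g :
    (Q <= U)%MS -> U *m Q = U -> g \in G ->
  cfRepr (submod_repr Umod) g = \tr (Q *m rG g).
Proof.
move=> sQU UQ Gg; rewrite cfunE Gg.
have [X defQ] : exists X, Q = X *m row_base U.
  by apply/submxP; rewrite eq_row_base.
have BX : row_base U *m X = 1%:M.
  apply: (row_free_inj (row_base_free U)); rewrite mul1mx -mulmxA -defQ.
  have /submxP[Y ->] : (row_base U <= U)%MS by rewrite eq_row_base.
  by rewrite -mulmxA UQ.
have := val_submodJ Umod 1%:M Gg; rewrite /val_submod /= !mul1mx => subg.
by rewrite defQ -(mulmxA X) (mxtrace_mulC X) -subg -(mulmxA (submod_mx _ _)) BX
  mulmx1.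
Qed.

(** The averaging of Maschke's theorem. *)
Definition mx_average (X : 'M[algC]_n) : 'M[algC]_n :=
  #|G|%:R^-1 *: \sum_(g in G) (rG g^-1%g *m X *m rG g).

Lemma mx_average_intertwines X : intertwines (mx_average X).
Proof.
move=> h Gh; rewrite /mx_average -scalemxAl -scalemxAr; congr (_ *: _).
rewrite mulmx_sumr mulmx_suml (reindex_inj (mulIg h)) /=.
apply: eq_big => [g|g]; first by rewrite groupMr.
rewrite groupMr // => Gg.
rewrite invMg !repr_mxM ?groupV // !mulmxA.
by rewrite -(repr_mxM _ Gh) ?groupV // mulgV repr_mx1 mul1mx.
Qed.

Lemma mx_average_mulr X Q :
  intertwines Q -> mx_average X *m Q = mx_average (X *m Q).
Proof.
move=> cQ; rewrite /mx_average -scalemxAl mulmx_suml; congr (_ *: _).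
by apply: eq_bigr => g Gg; rewrite -!mulmxA cQ.
Qed.

Lemma mx_average_id (U X : 'M[algC]_n) :
  mxmodule rG U -> U *m X = U -> U *m mx_average X = U.
Proof.
move=> Umod UX; rewrite /mx_average -scalemxAr mulmx_sumr.
rewrite (eq_bigr (fun=> U)) => [|g Gg]; last first.
  have /submxP[Y defY] : (U *m rG g^-1%g <= U)%MS.
    by rewrite (mxmoduleP Umod) ?groupV.
  by rewrite !mulmxA defY -!(mulmxA Y) UX mulmxA -defY repr_mxKV.
rewrite sumr_const -scaler_nat scalerA mulVf ?scale1r //.
exact: neq0CG.
Qed.

Lemma mx_average_sub (U X : 'M[algC]_n) :
  mxmodule rG U -> (X <= U)%MS -> (mx_average X <= U)%MS.
Proof.
move=> Umod sXU; rewrite /mx_average scalemx_sub // summx_sub // => g Gg.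
by rewrite -mulmxA mulmx_sub // (submx_trans (submxMr _ sXU)) ?(mxmoduleP Umod).
Qed.

(* [f] maps the image of [P] onto a module containing [U], so that [U] is a
   subquotient of that image; averaging makes the section of [f] equivariant. *)
Lemma subquotient_char_le P f U (Umod : mxmodule rG U) :
    intertwines P -> P *m P = P -> intertwines f -> (U <= P *m f)%MS ->
  exists2 A : 'CF(G),
    [/\ A \is a character & A - cfRepr (submod_repr Umod) \is a character]
    & forall g, g \in G -> A g = \tr (P *m rG g).
Proof.
move=> cP PP cf /submxP[Z defU].
(* [pinvmx U *m U] projects onto [U], so [pinvmx U *m Z] is a section of [P *m f] over [U];
   averaging turns this projection into the equivariant [Q]. *)
pose X := mx_average (pinvmx U *m Z).
have cX : intertwines X by apply: mx_average_intertwines.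
have cPf := intertwines_mul cP cf.
have [Q XPf] : exists Q, X *m (P *m f) = Q by eexists.
have defQ : Q = mx_average (pinvmx U *m U).
  by rewrite -XPf /X mx_average_mulr // -mulmxA -defU.
have UQ : U *m Q = U.
  by rewrite defQ mx_average_id // mulmxA mulmxKpV.
have sQU : (Q <= U)%MS by rewrite defQ mx_average_sub ?submxMl.
have QQ : Q *m Q = Q.
  by have /submxP[Y defY] := sQU; rewrite {1}defY -mulmxA UQ -defY.
have cQ : intertwines Q by rewrite -XPf; apply: intertwines_mul.
(* [N] transports [Q] into the image of [P]: an idempotent below [P] with the same traces as [Q].
   Hence [P - N] is an idempotent whose image carries the difference of the characters. *)
pose N := P *m f *m Q *m X *m P.
have cN : intertwines N by do !apply: intertwines_mul.
have PN : P *m N = N by rewrite /N !mulmxA PP.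
have NP : N *m P = N by rewrite /N -!mulmxA PP.
have NN : N *m N = N.
  have -> : N *m N = P *m f *m (Q *m (X *m (P *m P *m f)) *m Q) *m X *m P.
    by rewrite /N !mulmxA.
  by rewrite PP XPf !QQ.
have trN g : g \in G -> \tr (N *m rG g) = \tr (Q *m rG g).
  move=> Gg; have -> : N *m rG g = P *m f *m (Q *m rG g *m X *m P).
    by rewrite /N -!mulmxA -cP // (mulmxA X) -cX // !mulmxA.
  rewrite mxtrace_mulC.
  have -> : Q *m rG g *m X *m P *m (P *m f) = Q *m rG g *m (X *m (P *m P *m f)).
    by rewrite !mulmxA.
  by rewrite PP XPf -mulmxA cQ // mulmxA QQ.
have cPN := intertwines_sub cP cN.
have PNPN : (P - N) *m (P - N) = P - N.
  by rewrite mulmxBl !mulmxBr PP PN NP NN subrr subr0.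
exists (cfRepr (submod_repr (intertwines_mxmodule cP))); last first.
  by move=> g Gg; rewrite (cfRepr_submod_trace _ (submx_refl P)).
split; first exact: cfRepr_char.
suff -> : cfRepr (submod_repr (intertwines_mxmodule cP))
    - cfRepr (submod_repr Umod) = cfRepr (submod_repr (intertwines_mxmodule cPN)).
  exact: cfRepr_char.
apply/cfun_inP => g Gg; rewrite !cfunE.
have:= cfRepr_submod_trace (intertwines_mxmodule cP) (submx_refl P) PP Gg.
have:= cfRepr_submod_trace Umod sQU UQ Gg.
have:= cfRepr_submod_trace (intertwines_mxmodule cPN) (submx_refl _) PNPN Gg.
rewrite !cfunE => -> -> ->.
by rewrite mulmxBl !raddfB /= trN.
Qed.

End Projections.

(** * Left multiplications as endomorphisms of the regular representation *)

Section LeftRegular.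

Variables (gT : finGroupType) (G : {group gT}).
Local Notation reg := (regular_repr algC G).

(** [regular_repr] multiplies on the right, hence commutes with these matrices. Acting on row
    vectors, they compose in reverse order. *)
Definition left_mx (s : gT) : 'M[algC]_#|G| :=
  \matrix_i delta_mx 0 (gring_index G (s * enum_val i)%g).

Lemma left_mxM s t :
  s \in G -> left_mx s *m left_mx t = left_mx (t * s)%g.
Proof.
move=> Gs; apply/row_matrixP=> i; rewrite row_mul !rowK -rowE rowK.
by rewrite gring_indexK ?mulgA // groupM ?enum_valP.
Qed.

Lemma left_mx_intertwines s : s \in G -> intertwines reg (left_mx s).
Proof.
move=> Gs g Gg; apply/row_matrixP=> i; rewrite !row_mul !rowK -!rowE !rowK.
by rewrite !gring_indexK ?mulgA ?groupM ?enum_valP.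
Qed.

(** Left and right multiplication by [s] agree on the identity, so an element of the group algebra
    is the image of the identity under an intertwining matrix. *)
Lemma gring_row_regular s :
  s \in G -> gring_row (reg s) = gring_row 1%:M *m left_mx s.
Proof.
move=> Gs; rewrite -(repr_mx1 reg) /gring_row !rowK -rowE rowK.
by rewrite !(gring_indexK, mul1g, mulg1, groupM, group1).
Qed.

(** The product permutes the basis by sending [x] to [s * x * g], and a trace counts fixed
    points. *)
Lemma mxtrace_left_regular s g : s \in G -> g \in G ->
  \tr (left_mx s *m reg g) = #|[set x in G | (s * x * g == x)%g]|%:R.
Proof.
move=> Gs Gg.
have -> : left_mx s *m reg g =
    \matrix_i delta_mx 0 (gring_index G (s * enum_val i * g)%g).
  apply/row_matrixP=> i; rewrite row_mul !rowK -rowE rowK.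
  by rewrite gring_indexK // groupM ?enum_valP.
rewrite -sum1dep_card natr_sum big_mkcondr /= big_enum_val.
apply: eq_bigr => i _; rewrite !mxE /= -(inj_eq enum_val_inj).
rewrite gring_indexK ?groupM ?enum_valP // eq_sym.
by case: eqP.
Qed.

(** For a subgroup [K] of [G] on which [e] is multiplicative, this is [#|K|] times an idempotent. *)
Definition twisted_sum (e : gT -> algC) (K : {set gT}) : 'M[algC]_#|G| :=
  \sum_(x in K) e x *: left_mx x.

Lemma twisted_sum_intertwines e (K : {group gT}) :
  K \subset G -> intertwines reg (twisted_sum e K).
Proof.
move=> sKG g Gg; rewrite /twisted_sum mulmx_sumr mulmx_suml.
apply: eq_bigr => x Kx; rewrite -scalemxAl -scalemxAr.
by rewrite left_mx_intertwines // (subsetP sKG).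
Qed.

Variables (e : gT -> algC) (K : {group gT}).
Hypothesis sKG : K \subset G.
Hypothesis eM : {in K &, forall x y, e (x * y)%g = e x * e y}.

Lemma left_mx_twisted_sum x :
  x \in K -> e x *: (left_mx x *m twisted_sum e K) = twisted_sum e K.
Proof.
move=> Kx; rewrite /twisted_sum mulmx_sumr scaler_sumr.
rewrite [RHS](reindex_inj (mulIg x)); apply: eq_big => [y|y Ky].
  by rewrite groupMr.
rewrite -scalemxAr scalerA left_mxM ?(subsetP sKG) //.
by rewrite eM // mulrC.
Qed.

Lemma twisted_sum_left_mx x :
  x \in K -> e x *: (twisted_sum e K *m left_mx x) = twisted_sum e K.
Proof.
move=> Kx; rewrite /twisted_sum mulmx_suml scaler_sumr.
rewrite [RHS](reindex_inj (mulgI x)); apply: eq_big => [y|y Ky].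
  by rewrite groupMl.
by rewrite -scalemxAl scalerA left_mxM ?(subsetP sKG) // eM.
Qed.

Lemma twisted_sum_mull (A : {group gT}) : A \subset K ->
  twisted_sum e A *m twisted_sum e K = #|A|%:R *: twisted_sum e K.
Proof.
move=> sAK; rewrite {1}/twisted_sum mulmx_suml.
rewrite (eq_bigr (fun=> twisted_sum e K)) => [|x Ax].
  by rewrite sumr_const scaler_nat.
by rewrite -scalemxAl left_mx_twisted_sum ?(subsetP sAK).
Qed.

Lemma twisted_sum_mulr (A : {group gT}) : A \subset K ->
  twisted_sum e K *m twisted_sum e A = #|A|%:R *: twisted_sum e K.
Proof.
move=> sAK; rewrite {2}/twisted_sum mulmx_sumr.
rewrite (eq_bigr (fun=> twisted_sum e K)) => [|x Ax].
  by rewrite sumr_const scaler_nat.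
by rewrite -scalemxAr twisted_sum_left_mx ?(subsetP sAK).
Qed.

Lemma gring_row_twisted_sum :
  gring_row (\sum_(x in K) e x *: reg x) = gring_row 1%:M *m twisted_sum e K.
Proof.
rewrite raddf_sum mulmx_sumr; apply: eq_bigr => x Kx.
by rewrite -scalemxAr -gring_row_regular ?(subsetP sKG) // -linearZ.
Qed.

End LeftRegular.

(** * A character dominating that of the ideal of a symmetrizer *)

Section InducedBound.

Variables (gT : finGroupType) (G K1 K2 A B H : {group gT}) (e : gT -> algC).
Local Notation reg := (regular_repr algC G).
Hypotheses (sK1G : K1 \subset G) (sK2G : K2 \subset G).
Hypotheses (sAK1 : A \subset K1) (sBK2 : B \subset K2).
Hypotheses (defH : (A \x B)%g = H).
Hypothesis e_norm : forall x, `|e x| = 1.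
Hypothesis eM : {in K2 &, forall x y, e (x * y)%g = e x * e y}.

Let y := (\sum_(p in K1) reg p) *m (\sum_(q in K2) e q *: reg q).

(* Let [a] and [b] be the averages over [A] and [B], the second one twisted by
   [e].  The factors [R] and [C] of [y] absorb them, [y = R a b C], so the ideal
   of [y] is a subquotient of that of the idempotent [a b]. *)
Lemma young_ideal_char_le :
  exists F : 'CF(G),
  [/\ F \is a character,
      F - cfRepr (submod_repr (cyclic_mx_module reg (gring_row y)))
        \is a character
    & forall g, g \in G -> `|F g| <= #|H|%:R^-1
        * \sum_(h in H) #|[set x in G | (h * x * g == x)%g]|%:R].
Proof.
pose one_ (x : gT) : algC := 1.
have oneM (K : {group gT}) : {in K &, forall x y, one_ (x * y)%g = one_ x * one_ y}.
  by move=> *; rewrite mulr1.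
have sAG := subset_trans sAK1 sK1G; have sBG := subset_trans sBK2 sK2G.
have eMB : {in B &, forall x y, e (x * y)%g = e x * e y}.
  by move=> u v Bu Bv; rewrite eM ?(subsetP sBK2).
pose a := #|A|%:R^-1 *: twisted_sum G one_ A.
pose b := #|B|%:R^-1 *: twisted_sum G e B.
pose f := twisted_sum G one_ K1.
have aa : a *m a = a.
  rewrite /a -scalemxAl -scalemxAr twisted_sum_mull //.
  by rewrite !scalerA mulfVK ?neq0CG.
have bb : b *m b = b.
  rewrite /b -scalemxAl -scalemxAr twisted_sum_mull //.
  by rewrite !scalerA mulfVK ?neq0CG.
have [_ _ cAB _] := dprodP defH.
have abC : a *m b = b *m a.
  rewrite /a /b -!scalemxAl -!scalemxAr !scalerA mulrC; congr (_ *: _).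
  rewrite /twisted_sum mulmx_sumr mulmx_suml; apply: eq_bigr => u Bu.
  rewrite mulmx_sumr mulmx_suml; apply: eq_bigr => v Av.
  rewrite -!scalemxAl -!scalemxAr !scalerA mulrC; congr (_ *: _).
  have [Gv Gu] := (subsetP sAG v Av, subsetP sBG u Bu); rewrite !left_mxM //.
  by congr left_mx; apply: (centsP cAB).
have af : a *m f = f.
  by rewrite /a -scalemxAl twisted_sum_mull // scalerA mulVf ?scale1r ?neq0CG.
have Cb : twisted_sum G e K2 *m b = twisted_sum G e K2.
  by rewrite /b -scalemxAr twisted_sum_mulr // scalerA mulVf ?scale1r ?neq0CG.
have cf : intertwines reg f by apply: twisted_sum_intertwines.
have ca : intertwines reg a.
  by move=> g Gg; rewrite -scalemxAr -scalemxAl twisted_sum_intertwines.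
have cb : intertwines reg b.
  by move=> g Gg; rewrite -scalemxAr -scalemxAl twisted_sum_intertwines.
(* Since [f] commutes with right multiplication, the vector of [y] is that of its column factor
   followed by [f]. The column factor absorbs [b] and [f] absorbs [a], so both can be inserted
   between them. *)
have rowC : gring_row (\sum_(q in K2) e q *: reg q) *m (b *m a *m f) = gring_row y.
  rewrite gring_row_twisted_sum //.
  have -> : gring_row 1%:M *m twisted_sum G e K2 *m (b *m a *m f)
      = gring_row 1%:M *m (twisted_sum G e K2 *m b) *m (a *m f).
    by rewrite !mulmxA.
  rewrite af Cb -gring_row_twisted_sum // /y gring_row_mul.
  have -> : \sum_(p in K1) reg p = \sum_(p in K1) one_ p *: reg p.
    by apply: eq_bigr => p _; rewrite scale1r.
  rewrite (gring_row_twisted_sum one_) // -[X in gring_row X *m f]mul1mx.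
  rewrite gring_row_mul -!mulmxA; congr (_ *m _).
  rewrite mulmx_suml mulmx_sumr; apply: eq_bigr => q K2q.
  by rewrite -scalemxAl -scalemxAr cf ?(subsetP sK2G).
have cP := intertwines_mul cb ca.
have PP : b *m a *m (b *m a) = b *m a.
  by rewrite mulmxA -(mulmxA b) abC mulmxA bb -mulmxA aa.
have sub : (cyclic_mx reg (gring_row y) <= b *m a *m f)%MS.
  apply: cyclic_mx_sub; last by rewrite -rowC submxMl.
  exact: intertwines_mxmodule (intertwines_mul cP cf).
have [F [charF charFy] trF] :=
  subquotient_char_le (cyclic_mx_module reg (gring_row y)) cP PP cf sub.
exists F; split=> // g Gg; rewrite {}trF //.
pose N h := #|[set x in G | (h * x * g == x)%g]|%:R : algC.
have -> : \tr (b *m a *m reg g) = #|H|%:R^-1 *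
    \sum_(v in A) \sum_(u in B) e u * N (v * u)%g.
  rewrite -(dprod_card defH) natrM invfM -abC /a /b -!scalemxAl -scalemxAr.
  rewrite -scalemxAl !mxtraceZ -mulrA; congr (_ * (_ * _)).
  rewrite /twisted_sum !mulmx_suml raddf_sum; apply: eq_bigr => v Av.
  rewrite -!scalemxAl scale1r mulmx_sumr mulmx_suml raddf_sum.
  apply: eq_bigr => u Bu; rewrite /= -scalemxAr -scalemxAl mxtraceZ.
  have [Gv Gu] := (subsetP sAG v Av, subsetP sBG u Bu).
  rewrite left_mxM // mxtrace_left_regular ?groupM //.
  by rewrite (centsP cAB).
(* As [e] has modulus 1, the triangle inequality drops the twist and the double sum becomes one over
   [H]. *)
rewrite normrM ger0_norm ?invr_ge0 // ler_wpM2l ?invr_ge0 //.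
rewrite (reindex_dprod defH) (le_trans (ler_norm_sum _ _ _)) //.
apply: ler_sum => v _; rewrite (le_trans (ler_norm_sum _ _ _)) //.
by apply: ler_sum => u _; rewrite normrM e_norm mul1r ger0_norm.
Qed.

End InducedBound.

(** * Fixed colourings, Burnside counting and colour-preserving permutations *)

Section Colourings.

Variable n : nat.

Definition fixed_colourings (T : finType) (g : 'S_n) : {set n.-tuple T} :=
  [set t : n.-tuple T | [forall i, tnth t (g i) == tnth t i]].

(** Zipping two fixed colourings gives a fixed colouring by pairs, injectively. *)
Lemma card_fixed_colourings_prod (S T : finType) (g : 'S_n) :
  (#|fixed_colourings S g| * #|fixed_colourings T g|
     <= #|fixed_colourings (S * T)%type g|)%N.
Proof.
rewrite -cardsX.
pose z (u : n.-tuple S * n.-tuple T) : n.-tuple (S * T)%type :=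
  [tuple (tnth u.1 i, tnth u.2 i) | i < n].
have z_inj : injective z.
  move=> [s t] [s' t'] eqz; congr (_, _); apply: eq_from_tnth => i;
    by have /(congr1 (fun u => tnth u i)) := eqz; rewrite !tnth_mktuple => -[].
rewrite -(card_imset _ z_inj) subset_leq_card //.
apply/subsetP=> _ /imsetP[[s t] /setXP[/= /[!inE] /forallP fs /forallP ft] ->].
apply/forallP=> i; rewrite !tnth_mktuple /=.
by rewrite (eqP (fs i)) (eqP (ft i)).
Qed.

Section Burnside.

Variable T : finType.

(** The inverse makes this a right action for the product [s * t] that applies [s] first. *)
Definition recolour (t : n.-tuple T) (g : 'S_n) : n.-tuple T :=
  [tuple tnth t (g^-1%g i) | i < n].

Lemma recolour_is_action : is_action [set: 'S_n] recolour.
Proof.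
apply: is_total_action => [t|t g h]; apply: eq_from_tnth => i.
  by rewrite tnth_mktuple invg1 perm1.
by rewrite !tnth_mktuple invMg permM.
Qed.

Canonical recolour_action := Action recolour_is_action.

(** Counts never exceed [n], so [inord] loses nothing, and the finite codomain bounds the number of
    orbits. *)
Definition content (t : n.-tuple T) : {ffun T -> 'I_n.+1} :=
  [ffun x => inord (count_mem x t)].

Lemma content_perm_eq (s t : n.-tuple T) :
  (content s == content t) = perm_eq s t.
Proof.
apply/eqP/idP => [eqst|/seq.permP eqst].
  apply/allP=> x _ /=.
  have /ffunP/(_ x) := eqst; rewrite !ffunE => /(congr1 (@nat_of_ord _)).
  have le_n (u : n.-tuple T) : (count_mem x u < n.+1)%N.
    by rewrite ltnS -[X in (_ <= X)%N](size_tuple u) count_size.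
  by rewrite !inordK => [->||].
by apply/ffunP=> x; rewrite !ffunE eqst.
Qed.

Lemma orbit_recolour (t : n.-tuple T) :
  orbit recolour_action [set: 'S_n] t = [set s | content s == content t].
Proof.
apply/setP=> s; rewrite inE content_perm_eq; apply/orbitP/tuple_permP.
  by case=> g _ <-; exists g^-1%g.
case=> g defs; exists g^-1%g; rewrite ?inE //.
by apply: val_inj; rewrite /= defs invgK.
Qed.

Lemma sum_card_fixed_colourings :
  (\sum_(g : 'S_n) #|fixed_colourings T g| <= n.+1 ^ #|T| * #|[set: 'S_n]|)%N.
Proof.
have actS : [acts [set: 'S_n], on [set: n.-tuple T] | recolour_action].
  by apply/subsetP=> g _; rewrite !inE; apply/subsetP=> t; rewrite !inE.
have <- : (\sum_(g in [set: 'S_n]) #|('Fix_([set: n.-tuple T] | recolour_action)[g])%g|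
    = \sum_(g : 'S_n) #|fixed_colourings T g|)%N.
  apply: eq_big => [g|g _]; first by rewrite inE.
  congr #|pred_of_set _|; apply/setP=> t; rewrite !inE sub1set inE /=.
  apply/eqP/forallP=> [fix_t i|fix_t].
    by rewrite -{1}fix_t /recolour tnth_mktuple permK.
  apply: eq_from_tnth => i; rewrite tnth_mktuple.
  by rewrite -[in RHS](permKV g i) (eqP (fix_t _)).
rewrite (Frobenius_Cauchy actS) leq_mul2r; apply/orP; right.
pose level (w : {ffun T -> 'I_n.+1}) := [set s : n.-tuple T | content s == w].
have -> : (n.+1 ^ #|T| = #|[set: {ffun T -> 'I_n.+1}]|)%N.
  by rewrite cardsT card_ffun card_ord.
apply: leq_trans (leq_imset_card level _); apply: subset_leq_card.
apply/subsetP=> _ /imsetP[t _ ->]; apply/imsetP; exists (content t) => //.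
exact: orbit_recolour.
Qed.

End Burnside.

Section Stabiliser.

Variables (T : eqType) (c : 'I_n -> T).

Definition colour_stab : {set 'S_n} :=
  [set s : 'S_n | [forall i, c (s i) == c i]].

Lemma colour_stabP (s : 'S_n) : reflect (forall i, c (s i) = c i) (s \in colour_stab).
Proof. by rewrite inE; apply: (iffP forallP) => cs i; apply/eqP. Qed.

Lemma colour_stab_group_set : group_set colour_stab.
Proof.
apply/group_setP; split=> [|s t /colour_stabP cs /colour_stabP ct].
  by apply/colour_stabP=> i; rewrite perm1.
by apply/colour_stabP=> i; rewrite permM ct cs.
Qed.

Canonical colour_stab_group := Group colour_stab_group_set.

(** The hypothesis makes [S] a union of colour classes, hence stable under colour-preserving
    permutations; each of these splits into its restriction to [S] and a permutation fixing [S]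
    pointwise. *)
Lemma colour_stab_dprod (S : {set 'I_n}) :
    (forall i j, c i = c j -> (i \in S) = (j \in S)) ->
  ('C_colour_stab(~: S | 'P) \x 'C_colour_stab(S | 'P) = colour_stab)%g.
Proof.
move=> cS; rewrite dprodE.
- apply/setP=> s; apply/mulsgP/idP => [[p q /setIP[cp _] /setIP[cq _] ->]|cs].
    by rewrite (groupM cp cq).
  have cis := colour_stabP _ cs.
  have Ns : s \in 'N(S | 'P)%g by apply/astabsP=> i; apply: cS; exact: cis.
  pose p := restr_perm S s.
  have pS i : i \in S -> p i = s i by move=> Si; rewrite restr_permE.
  have pC i : i \notin S -> p i = i by apply/out_perm/restr_perm_on.
  have cp : p \in colour_stab.
    apply/colour_stabP=> i.
    by have [/pS ->|/pC ->] := boolP (i \in S); rewrite ?cis.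
  exists p (p^-1 * s)%g; last by rewrite mulKVg.
    by rewrite inE cp; apply/astabP=> i; rewrite inE => /pC.
  rewrite inE groupM ?groupV //; apply/astabP=> i Si /=.
  rewrite apermE permM.
  have Spi : p^-1%g i \in S.
    by apply/idPn=> nS; case/negP: (nS); rewrite -(pC _ nS) permKV.
  by rewrite -pS ?permKV.
- apply/centsP=> q /setIP[_ /astabP qS] p /setIP[_ /astabP pC].
  have {}qS i : i \in S -> q i = i by apply: qS.
  have {}pC i : i \notin S -> p i = i by move=> Si; apply: pC; rewrite inE.
  apply/permP=> i; rewrite !permM; have [Si|S'i] := boolP (i \in S).
    rewrite (qS i) // qS //; apply/idPn=> nS; case/negP: (nS).
    by rewrite (perm_inj (pC _ nS)).
  rewrite (pC i) // pC //; apply: contra S'i => Sqi.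
  by rewrite -[i](perm_inj (qS _ Sqi)).
apply/trivgP/subsetP=> s /setIP[/setIP[_ /astabP sC] /setIP[_ /astabP sS]].
rewrite inE; apply/eqP/permP=> i; rewrite perm1.
by have [/sS|S'i] := boolP (i \in S); last by apply: sC; rewrite inE.
Qed.

End Stabiliser.

(** Double counting. Each [x] admits at most one [h], namely [x * g^-1 * x^-1], and if it preserves
    colours then [g] fixes the colouring [col x]. The [x] with a given [col x] lie in one right
    coset of [colour_stab c]. *)
Lemma sum_conjugates_colour_stab (T : finType) (c : 'I_n -> T) (g : 'S_n) :
  (\sum_(h in colour_stab c) #|[set x in [set: 'S_n] | (h * x * g == x)%g]|
    <= #|colour_stab c| * #|fixed_colourings T g|)%N.
Proof.
pose col (x : 'S_n) : n.-tuple T := [tuple c (x^-1%g i) | i < n].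
under eq_bigr => h _ do rewrite -sum1dep_card big_mkcond.
rewrite exchange_big /= (bigID (fun x => col x \in fixed_colourings T g)) /=.
rewrite [X in (_ + X)%N]big1 ?addn0 => [|x not_fix]; last first.
  apply: big1 => h /colour_stabP ch; rewrite inE /=.
  case: eqP => // hxg; case/negP: not_fix; rewrite inE; apply/forallP=> j.
  rewrite !tnth_mktuple.
  pose i := h^-1%g (x^-1%g j).
  have xhi : x (h i) = j by rewrite /i !permKV.
  have gj : g j = x i by rewrite -xhi -[in RHS]hxg !permM.
  by rewrite gj permK -xhi permK ch.
apply: leq_trans (_ : \sum_(x | col x \in fixed_colourings T g) 1 <= _)%N.
  apply: leq_sum => x _; rewrite -big_mkcondr /= sum1dep_card.
  rewrite -(cards1 (x * (g^-1 * x^-1))%g) subset_leq_card //.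
  apply/subsetP=> h /[!inE] /= /andP[_ /eqP hxg].
  by rewrite mulgA -{1}hxg !mulgK.
rewrite (partition_big col (mem (fixed_colourings T g))) //= mulnC -sum_nat_const.
apply: leq_sum => t _; rewrite sum1dep_card.
set X := [set _ | _]; have [->|[x0]] := set_0Vmem X; first by rewrite cards0.
rewrite inE => /andP[_ /eqP colx0]; rewrite -(card_rcoset (colour_stab c) x0).
apply: subset_leq_card; apply/subsetP=> x; rewrite inE => /andP[_ /eqP colx].
rewrite mem_rcoset; apply/colour_stabP=> i; rewrite permM.
have /(congr1 (fun u => tnth u (x i))) := etrans colx (esym colx0).
by rewrite !tnth_mktuple permK => <-.
Qed.

End Colourings.

(** * The standard tableau and the nonvanishing of Young characters *)

Section Young.

Variables (n : nat) (lam : intpart n).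
Local Notation reg := (regular_repr algC [set: 'S_n]%G).

Lemma sumn_parts : sumn (parts lam) = n.
Proof. by have /andP[_ /eqP] := valP lam. Qed.

Lemma part_anti i j : (i <= j)%N -> (part lam j <= part lam i)%N.
Proof.
have /andP[sorted_lam _] := valP lam; rewrite /part => le_ij.
have [lt_j|ge_j] := ltnP j (size (parts lam)); last by rewrite nth_default.
have geq_trans : transitive geq by move=> y x z /= xy yz; apply: leq_trans yz xy.
apply: (sorted_leq_nth geq_trans leqnn) => //.
by rewrite inE (leq_ltn_trans le_ij).
Qed.

Lemma tableau_col_lt i :
  (tableau_col lam i < part lam (tableau_row lam i))%N.
Proof. by apply: reshape_offsetP; rewrite sumn_parts. Qed.

Lemma tableau_inj i j : tableau_row lam i = tableau_row lam j ->
  tableau_col lam i = tableau_col lam j -> i = j.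
Proof.
move=> eq_row eq_col; apply: val_inj => /=.
rewrite -[LHS](reshape_indexK (parts lam)) -[RHS](reshape_indexK (parts lam)).
by rewrite -/(tableau_row _ _) -/(tableau_col _ _) eq_row eq_col.
Qed.

(** The coefficient at the identity is 1: if [p * q = 1], then [p] preserves rows and columns, so it
    fixes every box. *)
Lemma young_symmetrizer_neq0 : gring_row (young_symmetrizer lam) != 0.
Proof.
apply/eqP => /(congr1 (fun u : 'rV_ _ => u 0 (gring_index [set: 'S_n]%G 1%g))).
rewrite /young_symmetrizer mulmx_suml.
under eq_bigr do rewrite mulmx_sumr.
rewrite raddf_sum summxE (bigD1 1%g) /=; last exact: (group1 (colour_stab_group _)).
rewrite raddf_sum summxE (bigD1 1%g) /=; last exact: (group1 (colour_stab_group _)).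
have entry p q : gring_row (reg p *m ((-1) ^+ odd_perm q *: reg q)) 0
    (gring_index [set: 'S_n]%G 1%g) = (-1) ^+ odd_perm q *+ (p * q == 1)%g.
  rewrite -scalemxAr linearZ mxE -repr_mxM ?inE //= /gring_row rowK.
  rewrite gring_indexK // mul1g !mxE /= mulr_natr eq_sym.
  by rewrite -(inj_eq enum_val_inj) !gring_indexK.
rewrite entry odd_perm1 mulg1 eqxx big1 => [|q /andP[_ q1]]; last first.
  by rewrite entry mul1g (negPf q1).
rewrite big1 => [|p /andP[row_p p1]].
  by rewrite !addr0 mxE => /eqP; rewrite oner_eq0.
rewrite raddf_sum summxE big1 // => q col_q; rewrite entry.
case: eqP => // pq1; case/negP: p1; apply/eqP/permP=> i; rewrite perm1.
have {}row_p := colour_stabP _ _ row_p.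
have col_p : p \in colour_stab (tableau_col lam).
  by rewrite (canRL (mulgK q) pq1) mul1g groupV.
apply: tableau_inj => //; exact: (colour_stabP _ _ col_p).
Qed.

(** This provides an irreducible constituent of [chi rho], through which [kappa rho] is bounded. *)
Lemma chi_neq0 : chi lam != 0.
Proof.
apply/eqP => /cfunP/(_ 1%g); rewrite cfRepr1 cfunE => /eqP.
rewrite pnatr_eq0 mxrank_eq0 cyclic_mx_eq0; apply/negP.
exact: young_symmetrizer_neq0.
Qed.

Lemma chi_char : chi lam \is a character.
Proof. exact: cfRepr_char. Qed.

End Young.

(** * The colouring of a hook shape *)

Lemma hook_char_le (k l n : nat) (lam : intpart n) : lam \in hook k l n ->
  exists F : 'CF([set: 'S_n]),
  [/\ F \is a character, F - chi lam \is a character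
    & forall g, `|F g| <= #|fixed_colourings 'I_(k + l).+1 g|%:R].
Proof.
rewrite inE => hook_lam.
pose row := tableau_row lam; pose col := tableau_col lam.
pose v i := if (row i < k)%N then row i else (k + col i)%N.
have v_lt i : (v i < (k + l).+1)%N.
  rewrite /v; case: (ltnP (row i) k) => [lt_row|ge_row].
    by rewrite ltnS ltnW // ltn_addr.
  (* Parts decrease, so every row below the first [k] has at most [l] boxes. *)
  rewrite ltnS leq_add2l ltnW //; apply: leq_trans (tableau_col_lt lam i) _.
  exact: leq_trans (part_anti lam ge_row) hook_lam.
(* Only colours below [k + l] occur; the last one makes [inord] available. *)
pose c i : 'I_(k + l).+1 := inord (v i).
have c_inj i j : c i = c j -> v i = v j.
  by move/(congr1 (@nat_of_ord _)); rewrite !inordK.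
pose S := [set i | (row i < k)%N].
have v_S i : (i \in S) = (v i < k)%N.
  by rewrite inE /v; case: (ltnP (row i) k) => // _; rewrite ltnNge leq_addr.
have defH : ('C_(colour_stab c)(~: S | 'P) \x 'C_(colour_stab c)(S | 'P)
    = colour_stab c)%g.
  by apply: colour_stab_dprod => i j /c_inj eqv; rewrite !v_S eqv.
pose K1 := colour_stab_group row; pose K2 := colour_stab_group col.
(* The first factor moves only boxes of the first [k] rows, where the colour is the row; the second
   moves only the other boxes, where the colour determines the column. *)
have sAK1 : ('C_(colour_stab c)(~: S | 'P) \subset K1)%g.
  apply/subsetP=> s /setIP[/colour_stabP cs /astabP fix_s].
  apply/colour_stabP=> i; have [Si|nSi] := boolP (i \in S); last first.
    by congr row; apply: fix_s; rewrite inE.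
  have Ssi : s i \in S by rewrite v_S (c_inj _ _ (cs i)) -v_S.
  by have := c_inj _ _ (cs i); rewrite /v; rewrite !inE in Si Ssi; rewrite Si Ssi.
have sBK2 : ('C_(colour_stab c)(S | 'P) \subset K2)%g.
  apply/subsetP=> s /setIP[/colour_stabP cs /astabP fix_s].
  apply/colour_stabP=> i; have [Si|nSi] := boolP (i \in S).
    by congr col; apply: fix_s.
  have nSsi : s i \notin S by rewrite v_S (c_inj _ _ (cs i)) -v_S.
  have := c_inj _ _ (cs i); rewrite /v; rewrite !inE in nSi nSsi.
  by rewrite (negPf nSi) (negPf nSsi) => /addnI.
pose e (q : 'S_n) : algC := (-1) ^+ odd_perm q.
have eM : {in K2 &, forall x y, e (x * y)%g = e x * e y}.
  by move=> x y _ _; rewrite /e odd_permM signr_addb.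
have e_norm q : `|e q| = 1 by apply: normr_sign.
have [F [charF charFlam leF]] := young_ideal_char_le (subsetT K1) (subsetT K2)
  sAK1 sBK2 defH e_norm eM.
exists F; split=> // g; apply: le_trans (leF g (in_setT g)) _.
rewrite ler_pdivrMl ?ltr0n ?cardG_gt0 // -natr_sum -natrM ler_nat.
exact: sum_conjugates_colour_stab.
Qed.

(** * From character norms to Kronecker multiplicities *)

Lemma char_mul_sub_char (gT : finGroupType) (G : {group gT})
    (F1 F2 chi1 chi2 : 'CF(G)) :
    chi1 \is a character -> F2 \is a character ->
    F1 - chi1 \is a character -> F2 - chi2 \is a character ->
  F1 * F2 - chi1 * chi2 \is a character.
Proof.
move=> char1 charF2 charF1 charF2'.
have -> : F1 * F2 - chi1 * chi2 = (F1 - chi1) * F2 + chi1 * (F2 - chi2).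
  by rewrite mulrBl mulrBr addrA subrK.
by rewrite rpredD // rpredM.
Qed.

(** The norm is the sum of the squared multiplicities, and a natural number is at most its
    square. *)
Lemma cfdot_irr_le_cfnorm (gT : finGroupType) (G : {group gT}) (F : 'CF(G)) i :
  F \is a character -> '[F, 'chi_i] <= '[F].
Proof.
move=> charF; have natF j : '[F, 'chi_j] \is a Num.nat by apply: Cnat_cfdot_char_irr.
rewrite [leRHS]cfdot_sum_irr (bigD1 i) //= ler_wpDr //.
  by apply: sumr_ge0 => j _; rewrite mul_conjC_ge0.
by rewrite conj_natr //; have /natrP[[|m] ->] := natF i; rewrite ?mulr0 //
  -natrM ler_nat leq_pmulr.
Qed.

Lemma kronecker_le (k l n : nat) (lam mu : intpart n) (kappa : intpart n -> nat) rho :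
    lam \in hook k l n -> mu \in hook k l n ->
    kronecker_multiplicities lam mu kappa ->
  (kappa rho <= n.+1 ^ ((k + l).+1 ^ 4))%N.
Proof.
move=> /hook_char_le[F1 [char1 le1 bound1]] /hook_char_le[F2 [char2 le2 bound2]] defK.
(* ['chi_i] occurs at least once in [chi rho] and nonnegatively often in every [chi nu], so
   [kappa rho] is at most its multiplicity in [chi lam * chi mu]. *)
have [i irr_i] := neq0_has_constt (chi_neq0 rho).
have nat_chi (nu : intpart n) : '[chi nu, 'chi_i] \is a Num.nat.
  by rewrite Cnat_cfdot_char_irr ?chi_char.
have F_char : F1 * F2 \is a character by rewrite rpredM.
pose T := 'I_(k + l).+1.
(* Two factors, each squared, give four counts of fixed colourings, which merge into colourings by
   quadruples; hence the exponent 4. *)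
have normF g : `|(F1 * F2) g| ^+ 2 <=
    #|fixed_colourings ((T * T) * (T * T))%type g|%:R.
  rewrite cfunE normrM exprMn.
  have le_prod : (#|fixed_colourings T g| ^ 2 * #|fixed_colourings T g| ^ 2
      <= #|fixed_colourings ((T * T) * (T * T))%type g|)%N.
    apply: leq_trans (card_fixed_colourings_prod _ _ _).
    by rewrite leq_mul // -mulnn card_fixed_colourings_prod.
  rewrite -(ler_nat algC) in le_prod; apply: le_trans le_prod.
  by rewrite natrM !natrX ler_pM ?exprn_ge0 // lerXn2r ?nnegrE.
rewrite -(ler_nat algC).
apply: (@le_trans _ _ '[chi lam * chi mu, 'chi_i]).
  rewrite defK cfdot_suml (bigD1 rho) //= cfdotZl.
  rewrite ler_wpDr ?sumr_ge0 // => [nu _|].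
    by rewrite cfdotZl mulr_ge0 // natr_ge0.
  rewrite ler_peMr //; move: irr_i; rewrite irr_consttE.
  by have /natrP[[|m] ->] := nat_chi rho; rewrite ?eqxx // ler1n.
apply: (@le_trans _ _ '[F1 * F2, 'chi_i]).
  rewrite -subr_ge0 -cfdotBl natr_ge0 // Cnat_cfdot_char_irr //.
  by rewrite char_mul_sub_char ?chi_char.
apply: le_trans (cfdot_irr_le_cfnorm i F_char) _.
rewrite (cfnormE (cfun_onG _)) ler_pdivrMl ?ltr0n ?cardG_gt0 //.
apply: le_trans (ler_sum _ (fun g _ => normF g)) _.
rewrite -natr_sum -natrM ler_nat mulnC.
under eq_bigl do rewrite inE.
apply: leq_trans (sum_card_fixed_colourings _ _) _.
have -> : ((k + l).+1 ^ 4 = #|{: (T * T) * (T * T)}|)%N.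
  by rewrite !card_prod card_ord (expnD _ 2 2) -mulnn.
by [].
Qed.

Theorem theorem1p3 (R : realType) (k l : nat) :
  exists a b : R,
    forall n : nat, (0 < n)%N ->
    forall lam mu : intpart n, lam \in hook k l n -> mu \in hook k l n ->
    forall kappa : intpart n -> nat, kronecker_multiplicities lam mu kappa ->
    forall rho : intpart n, (kappa rho)%:R <= a * n%:R `^ b.
Proof.
pose D := ((k + l).+1 ^ 4)%N.
(* For [n > 0], [n.+1 <= 2 * n], so [n.+1 ^ D] is at most [2 ^ D * n ^ D]. *)
exists (2 ^+ D), D%:R => n n_gt0 lam mu hook_lam hook_mu kappa defK rho.
rewrite powR_mulrn // -exprMn -natrM -natrX ler_nat.
apply: leq_trans (kronecker_le rho hook_lam hook_mu defK) _.
by rewrite leq_exp2r ?expn_gt0 // mul2n -addnn -add1n leq_add2r.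
Qed.
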